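(* Let $\rho\in(0,1]$, $\sigma\in[1,\infty)$, and let $x_k=\rho+\sigma+k-2$, $y_k=\rho(\sigma+k-1)$, $k\ge1$ (the shifted Charlier specialization). The $n$-th Stieltjes moment is $$a_n(\rho,\sigma)=\sum_{\pi\in\Pi(n)}\rho^{\#\mathrm{blocks}^\star(\pi)}\,\sigma^{\overline g_1(\pi)}\,(\rho+\sigma-1)^{\#\mathcal S(\pi)},$$ where the sum is over all set partitions $\pi$ of $\{1,\ldots,n\}$, $\#\mathrm{blocks}^\star(\pi)$ is the number of non-singleton blocks, $\#\mathcal S(\pi)$ is the number of singleton blocks, and $\overline g_1(\pi)$ is the number of closers $i$ of $\pi$ with $\gamma_i(\pi)=1$.
   Context: Moments (normalized by $a_0=1$): coefficients of the Jacobi continued fraction $$\sum_{n\ge0}a_nz^n=\cfrac{1}{1-x_1z-\cfrac{y_1z^2}{1-x_2z-\cfrac{y_2z^2}{1-x_3z-\ddots}}}\ ;$$ equivalently, $a_n$ is the sum over Motzkin paths of length $n$ of the product of step weights, where an up step from height $k-1$ to $k$ has weight $y_k$, a horizontal step at height $k$ has weight $x_{k+1}$, and down steps have weight $1$. Set partition notions: for a set partition $\pi$, $a$ precedes $b$ (and $b$ succeeds $a$) if they are consecutive elements of the same block listed in increasing order. An element is a singleton if its block has size one; an opener (resp. closer) if it is the minimum (resp. maximum) of a non-singleton block; a transient otherwise. $\Gamma_i(\pi)$ is the set of openers or transients $a<i$ such that $i\le b$, where $b$ is the element succeeding $a$. For $i$ a closer (or transient), $\gamma_i(\pi)$ is the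 position (starting from 1) of the element preceding $i$ in the increasing list of the elements of $\Gamma_i(\pi)$. *)

(* Defs.v *)
From HB Require Import structures.
From mathcomp Require Import all_boot all_order all_algebra reals.

Set Implicit Arguments.
Unset Strict Implicit.
Unset Printing Implicit Defensive.

Import Order.TTheory GRing.Theory Num.Theory.
Local Open Scope ring_scope.

(* A formal power series in z over R is its coefficient function nat -> R. *)
Section PowerSeries.
Variable R : comNzRingType.
Implicit Types f g u : nat -> R.

Definition fps_one : nat -> R := fun n => (n == 0)%:R.

Definition fps_mul f g : nat -> R := fun n => \sum_(i < n.+1) f i * g (n - i)%N.

(* 1 / (1 - u) = sum_m u^m for u without constant term: u^m has no terms of
   degree < m, so only the powers m <= n contribute to the coefficient of z^n. *)
Definition fps_geom u : nat -> R :=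
  fun n => \sum_(m < n.+1) iter m (fps_mul u) fps_one n.

(* The finite continued fraction with K levels
     1 / (1 - x_k z - y_k z^2 / (1 - x_(k+1) z - y_(k+1) z^2 / (...))),
   the last level being 1 / (1 - x_(k+K-1) z). *)
Fixpoint jfrac_convergent (x y : nat -> R) (K k : nat) : nat -> R :=
  if K is K'.+1 then
    fps_geom (fun n => match n with
                       | 0 => 0
                       | 1 => x k
                       | n'.+2 => y k * jfrac_convergent x y K' k.+1 n'
                       end)
  else fun=> 0.

(* Coefficient of z^n in the infinite J-fraction with parameters x_1, y_1, x_2,
   y_2, ...; its value at any depth K with n < 2 K is the same, see
   [jfrac_convergent_stable]. *)
Definition jfrac_moment (x y : nat -> R) (n : nat) : R :=
  jfrac_convergent x y n.+1 1 n.

Lemma fps_pow_eq0 u m n :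
  u 0%N = 0 -> (n < m)%N -> iter m (fps_mul u) fps_one n = 0.
Proof.
move=> u0; elim: m n => [|m IHm] n // ltnm.
rewrite iterS /fps_mul big1 // => -[[|i] ltin] _ /=; first by rewrite u0 mul0r.
rewrite IHm ?mulr0 // (@leq_trans n) ?ltn_subrL //.
exact: leq_trans (ltn0Sn i) _.
Qed.

Lemma fps_geomE u n N : u 0%N = 0 -> (n <= N)%N ->
  fps_geom u n = \sum_(m < N.+1) iter m (fps_mul u) fps_one n.
Proof.
move=> u0 lenN; rewrite /fps_geom.
rewrite (big_ord_widen _ (fun m => iter m (fps_mul u) fps_one n) (_ : n < N.+1)%N) //.
rewrite big_mkcond /=; apply: eq_bigr => m _.
by case: ltnP => // ltnm; rewrite fps_pow_eq0.
Qed.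

Lemma fps_geom_rec u n : u 0%N = 0 ->
  fps_geom u n = fps_one n + fps_mul u (fps_geom u) n.
Proof.
move=> u0; rewrite (fps_geomE u0 (leqnSn n)) big_ord_recl /=; congr (_ + _).
rewrite /fps_mul [RHS](eq_bigr (fun i : 'I_n.+1 =>
  \sum_(m < n.+1) u i * iter m (fps_mul u) fps_one (n - i)%N)).
  by rewrite exchange_big.
by move=> i _; rewrite (fps_geomE u0 (leq_subr i n)) mulr_sumr.
Qed.

Lemma fps_geom_inv u n : u 0%N = 0 ->
  fps_mul (fun k => fps_one k - u k) (fps_geom u) n = fps_one n.
Proof.
move=> u0; rewrite /fps_mul.
under eq_bigr do rewrite mulrBl.
rewrite sumrB big_ord_recl /= mul1r subn0 big1 ?addr0.
  by rewrite {1}fps_geom_rec // addrK.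
by move=> i _; rewrite /fps_one /= mul0r.
Qed.

Lemma fps_geom_local u v n : (forall i, (i <= n)%N -> u i = v i) ->
  fps_geom u n = fps_geom v n.
Proof.
move=> uv; apply: eq_bigr => -[m _] _ /=.
elim: m n uv => [|m IHm] n uv //.
rewrite !iterS; apply: eq_bigr => i _.
rewrite uv -1?ltnS //; congr (_ * _); apply: IHm => j lej; apply: uv.
exact: leq_trans lej (leq_subr _ _).
Qed.

Lemma jfrac_convergent_stable (x y : nat -> R) (K L k n : nat) :
  (n < K.*2)%N -> (K <= L)%N ->
  jfrac_convergent x y L k n = jfrac_convergent x y K k n.
Proof.
elim: K L k n => [|K IHK] [|L] k n //.
rewrite doubleS ltnS => ltnK leKL; apply: fps_geom_local => -[|[|i]] // lein.
by congr (_ * _); apply: IHK => //; exact: leq_trans lein ltnK.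
Qed.

End PowerSeries.

(* A set partition of {1, ..., n} is a P : {set {set 'I_n}} with
   [partition P [set: 'I_n]]; i : 'I_n stands for the element i + 1 (only the
   order of the elements matters below). *)
Section SetPartitions.
Variable n : nat.
Implicit Types (P : {set {set 'I_n}}) (a b i : 'I_n).

Definition precedes P a b : bool :=
  [exists B in P, [&& a \in B, b \in B, (a < b)%N &
                      [forall c in B, ~~ (a < c < b)%N]]].

Definition is_singleton P i : bool := [set i] \in P.

Definition is_opener P i : bool :=
  [exists B in P, [&& (1 < #|B|)%N, i \in B & [forall c in B, (i <= c)%N]]].

Definition is_closer P i : bool :=
  [exists B in P, [&& (1 < #|B|)%N, i \in B & [forall c in B, (c <= i)%N]]].

Definition is_transient P i : bool :=
  [&& ~~ is_singleton P i, ~~ is_opener P i & ~~ is_closer P i].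

Definition Gamma P i : {set 'I_n} :=
  [set a | [&& is_opener P a || is_transient P a, (a < i)%N &
               [exists b, precedes P a b && (i <= b)%N]]].

(* [enum] lists a set of ordinals in increasing order. An i that has no
   preceding element, i.e. is neither a closer nor a transient, gets the dummy
   value 0. *)
Definition gamma P i : nat :=
  if [pick a | precedes P a i] is Some a then (index a (enum (Gamma P i))).+1
  else 0.

Definition nonsingleton_blocks P : nat := #|[set B in P | (1 < #|B|)%N]|.

Definition singleton_blocks P : nat := #|[set B in P | #|B| == 1%N]|.

Definition g1bar P : nat := #|[set i | is_closer P i && (gamma P i == 1%N)]|.

End SetPartitions.

Section ShiftedCharlier.
Variables (R : realType) (rho sigma : R).

Definition charlier_x (k : nat) : R := rho + sigma + k%:R - 2.

Definition charlier_y (k : nat) : R := rho * (sigma + k%:R - 1).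

End ShiftedCharlier.

(* Main.v *)
Require Import Defs.
From HB Require Import structures.
From mathcomp Require Import all_boot all_order all_algebra reals.
From mathcomp Require Import ring zify.

Set Implicit Arguments.
Unset Strict Implicit.
Unset Printing Implicit Defensive.

Import Order.TTheory GRing.Theory Num.Theory.
Local Open Scope ring_scope.

(* Read a set partition from left to right, marking the blocks that are still
   to receive an element: their number is the height of a Motzkin path.  At
   height h a new element is a singleton or one of h possible transients (level
   steps, total weight rho + sigma - 1 + h), an opener (up step, weight rho), or
   one of h possible closers, exactly one of which closes the marked block whose
   last element is the smallest, i.e. has gamma = 1 (down steps, total weight
   sigma + h - 1).  Hence the sum over the marked partitions of the first k
   elements, each weighted by the Motzkin paths that complete it, does not
   depend on k; it is the moment at k = 0 and the partition sum at k = n. *)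

(** * Formal power series, J-fractions and weighted Motzkin paths *)

Section MotzkinPaths.
Variable R : comNzRingType.
Implicit Types f g : nat -> R.

Definition fps_shift f : nat -> R := fun n => if n is n'.+1 then f n' else 0.

(** Through truncation to polynomials, products of series inherit associativity and commutativity
    from [{poly R}]. *)
Lemma fps_mul_poly N f g n : (n < N)%N ->
  fps_mul f g n = ((\poly_(i < N) f i) * (\poly_(i < N) g i))`_n.
Proof.
move=> ltnN; rewrite coefM; apply: eq_bigr => i _.
have lei : (i <= n)%N by rewrite -ltnS.
by rewrite !coef_poly (leq_ltn_trans lei ltnN) (leq_ltn_trans (leq_subr i n) ltnN).
Qed.

Lemma fps_mulA f g (h : nat -> R) n :
  fps_mul f (fps_mul g h) n = fps_mul (fps_mul f g) h n.
Proof.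
rewrite !(@fps_mul_poly n.+1) //.
transitivity (((\poly_(i < n.+1) f i) *
  ((\poly_(i < n.+1) g i) * (\poly_(i < n.+1) h i)))`_n); last first.
  rewrite mulrA !coefM; apply: eq_bigr => i _; congr (_ * _).
  by rewrite [RHS]coef_poly ltn_ord (@fps_mul_poly n.+1).
rewrite !coefM; apply: eq_bigr => i _; congr (_ * _).
by rewrite [LHS]coef_poly ltnS leq_subr (@fps_mul_poly n.+1) // ltnS leq_subr.
Qed.

Lemma fps_mulC f g n : fps_mul f g n = fps_mul g f n.
Proof. by rewrite !(@fps_mul_poly n.+1) // mulrC. Qed.

Lemma fps_mul1l f n : fps_mul (@fps_one R) f n = f n.
Proof.
by rewrite /fps_mul big_ord_recl /= mul1r subn0 big1 ?addr0 // => i _; rewrite mul0r.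
Qed.

Lemma fps_mul_shift f g n :
  fps_mul (fps_shift f) g n = fps_shift (fps_mul f g) n.
Proof. by case: n => [|n]; rewrite /fps_mul big_ord_recl /= mul0r add0r ?big_ord0. Qed.

Lemma fps_mulDl f1 f2 g n :
  fps_mul (fun m => f1 m + f2 m) g n = fps_mul f1 g n + fps_mul f2 g n.
Proof. by rewrite -big_split; apply: eq_bigr => i _ /=; rewrite mulrDl. Qed.

Lemma fps_mulZl c f g n : fps_mul (fun m => c * f m) g n = c * fps_mul f g n.
Proof. by rewrite [RHS]mulr_sumr; apply: eq_bigr => i _; rewrite mulrA. Qed.

Lemma eq_fps_mul f1 f2 g n : f1 =1 f2 -> fps_mul f1 g n = fps_mul f2 g n.
Proof. by move=> eqf; apply: eq_bigr => i _; rewrite eqf. Qed.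

Section Jacobi.
Variables x y : nat -> R.

Definition jfrac k n : R := jfrac_convergent x y n.+1 k n.

Lemma jfrac_convergentE K k n : (n < K)%N ->
  jfrac_convergent x y K k n = jfrac k n.
Proof.
by move=> ltnK; apply: jfrac_convergent_stable => //; rewrite -addnn; lia.
Qed.

(** The equation J_k = 1 + z (x_k J_k + y_k z J_(k+1) J_k), got by clearing the denominator 1 - x_k
    z - y_k z^2 J_(k+1). Coefficients taken at different depths are reconciled by
    [jfrac_convergentE]. *)
Lemma jfrac_rec k n :
  jfrac k n = fps_one R n + fps_shift (fun m => x k * jfrac k m +
    y k * fps_shift (fps_mul (jfrac k.+1) (jfrac k)) m) n.
Proof.
rewrite {1}/jfrac [LHS]/= fps_geom_rec //; congr (_ + _).
rewrite /fps_mul big_ord_recl /= mul0r add0r; case: n => [|n].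
  by rewrite big_ord0.
rewrite big_ord_recl; congr (_ + _).
  by congr (_ * _); rewrite subn1; exact: (@jfrac_convergentE n.+2 k n (leqnSn _)).
case: n => [|n]; first by rewrite big_ord0 mulr0.
rewrite mulr_sumr; apply: eq_bigr => i _ /=.
rewrite -mulrA; congr (_ * (_ * _)).
  by exact: (@jfrac_convergentE n.+2 k.+1 i (ltnW (ltn_ord i))).
rewrite /bump /= !add1n !subSS.
by apply: (@jfrac_convergentE n.+3 k (n - i)); lia.
Qed.

End Jacobi.

Variables u l d : nat -> R.

(* Paths of length [m] from height [h] down to height 0. *)
Fixpoint motzkin (m h : nat) : R :=
  if m is m'.+1 then
    l h * motzkin m' h + u h * motzkin m' h.+1 +
    (if h is h'.+1 then d h * motzkin m' h' else 0)
  else (h == 0%N)%:R.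

Variables x y : nat -> R.
Hypothesis xE : forall k, x k.+1 = l k.
Hypothesis yE : forall k, y k.+1 = u k * d k.+1.

(* The first-passage decomposition: a path from height [h] is cut at its first
   descents to h-1, ..., 0, and the piece at height k contributes the J-fraction
   with parameters shifted by k. *)
Fixpoint descent (h : nat) : nat -> R :=
  if h is h'.+1 then
    fps_shift (fun m => d h * fps_mul (jfrac x y h.+1) (descent h') m)
  else jfrac x y 1.

(** Expanding the leading J-fraction by [jfrac_rec] sorts paths by their first step: at positive
    height the term 1 gives the down step; the x term gives the level step, and the y term an up
    step with its later return. *)
Lemma descent_rec h m :
  descent h m.+1 = l h * descent h m + u h * descent h.+1 m +
    (if h is h'.+1 then d h * descent h' m else 0).
Proof.
case: h => [|h].
  rewrite [LHS]jfrac_rec /= /fps_one /= add0r addr0 xE yE; congr (_ + _).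
  by case: m => [|m] /=; rewrite ?mulr0 // mulrA.
(* Levels of the fraction start at 1 and heights at 0, so height h+1 carries level h+2. Up to the
   factor z and [d h.+1], [F] is [descent h.+1]. *)
pose F := fps_mul (jfrac x y h.+2) (descent h).
have FE k : F k = descent h k + fps_shift (fun m => x h.+2 * F m +
    y h.+2 * fps_shift (fps_mul (jfrac x y h.+3) F) m) k.
  rewrite {1}/F (eq_fps_mul _ _ (jfrac_rec x y h.+2)) fps_mulDl fps_mul1l.
  rewrite fps_mul_shift; congr (_ + _); case: k => [|k] //=.
  rewrite fps_mulDl !fps_mulZl fps_mul_shift; congr (_ + _ * _).
  by case: k => [|k] //=; rewrite -fps_mulA.
have PE k : descent h.+1 k.+1 = d h.+1 * F k by [].
have PE2 k : descent h.+2 k.+1 =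
    d h.+2 * (d h.+1 * fps_shift (fps_mul (jfrac x y h.+3) F) k).
  rewrite /= fps_mulC -/F fps_mul_shift; congr (_ * _).
  by case: k => [|k] /=; rewrite ?mulr0 // fps_mulZl fps_mulC.
rewrite PE FE mulrDr addrC; congr (_ + _).
case: m => [|m]; first by rewrite /= !mulr0 addr0.
rewrite PE PE2 xE yE /=; ring.
Qed.

Lemma motzkin_jfrac_moment m : motzkin m 0 = jfrac_moment x y m.
Proof.
have descentE h : descent h m = motzkin m h.
  elim: m h => [|k IHk] h; last first.
    by rewrite descent_rec !IHk; case: h => // h; rewrite IHk.
  by case: h => [|h] //; rewrite [LHS]jfrac_rec /fps_one addr0.
by rewrite -descentE.
Qed.

End MotzkinPaths.

(** * Marked partitions and the insertion of a new element *)

Section MarkedPartitions.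
Variable T : finType.
Implicit Types (D B C X : {set T}) (P A S : {set {set T}}) (x : T).

Definition marked_partition D (s : {set {set T}} * {set {set T}}) : bool :=
  partition s.1 D && (s.2 \subset s.1).

(* [B = set0] adds the new block [[set x]]. *)
Definition extend_block x B S := (x |: B) |: (S :\ B).

(** Removing [set0] discards the remainder of the block [[set x]]. The remainder of [X] is added
    even when [X] is not in [S]: a block closed by [x] was marked just before. *)
Definition shrink_block x X S := (X :\ x |: S :\ X) :\ set0.

Lemma partition_notin P D B x : partition P D -> B \in P -> x \notin D -> x \notin B.
Proof. by move=> PD BP; apply: contra; apply: (subsetP (partitionS PD BP)). Qed.

Lemma partition_eq P D B C x : partition P D -> B \in P -> C \in P ->
  x \in B -> x \in C -> B = C.
Proof.
move=> /partition_trivIset tP BP CP xB xC.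
by rewrite -(def_pblock tP BP xB) -(def_pblock tP CP xC).
Qed.

Lemma partition_pblock P D x : partition P D -> x \in D ->
  pblock P x \in P /\ x \in pblock P x.
Proof.
move=> PD xD; have xP : x \in cover P by rewrite (cover_partition PD).
by rewrite pblock_mem ?mem_pblock.
Qed.

Lemma extend_block_partition x D B P : partition P D -> x \notin D ->
  B \in set0 |: P -> partition (extend_block x B P) (x |: D).
Proof.
move=> PD xD BP.
have [BD PDB] : B \subset D /\ partition (P :\ B) (D :\: B).
  move: BP; rewrite in_setU1 => /orP[/eqP->|BP].
    by rewrite sub0set setD0 (setDidPl _) // disjoint_sym disjoints1 (partition0 PD).
  by rewrite (partitionS PD BP) partitionD1.
have -> : x |: D = (x |: B) :|: (D :\: B).
  apply/setP=> y; rewrite !inE; have := subsetP BD y.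
  by case: (y \in B) => [->|_] //=; rewrite ?orbT ?orbF.
apply: partitionU1 => //; first by apply/set0Pn; exists x; rewrite setU11.
rewrite disjoints_subset; apply/subsetP=> y; rewrite !inE negb_and negbK.
by case/orP=> [/eqP->|->] //; rewrite xD orbT.
Qed.

Lemma shrink_block_partition x D X P : partition P (x |: D) -> x \notin D ->
  X \in P -> x \in X -> partition (shrink_block x X P) D.
Proof.
move=> PD xD XP xX; have PDX := partitionD1 PD XP.
have XD := partitionS PD XP; rewrite /shrink_block.
have [X0|Xn0] := eqVneq (X :\ x) set0.
  have XE : X = [set x] by rewrite -(setD1K xX) X0 setU0.
  rewrite X0 setU1K ?(partition0 PDX) //.
  by move: PDX; rewrite {2}XE setU1K.
have -> : (X :\ x |: P :\ X) :\ set0 = X :\ x |: P :\ X.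
  apply/setDidPl; rewrite disjoint_sym disjoints1 in_setU1 eq_sym.
  by rewrite (negbTE Xn0) (partition0 PDX).
have -> : D = (X :\ x) :|: ((x |: D) :\: X).
  apply/setP=> y; rewrite !inE; have := subsetP XD y; rewrite !inE.
  case: (eqVneq y x) => [->|_] /=; first by rewrite xX (negbTE xD).
  by case: (y \in X) => [->|_].
apply: partitionU1 => //; rewrite disjoints_subset; apply/subsetP=> y.
by rewrite !inE negb_and negbK => /andP[_ ->].
Qed.

(** [b = true] serves the set of all blocks and a marked result, [b = false] the set of marked
    blocks when the result is left unmarked. Both reduce to [B |: S :\ B] without [set0]. *)
Lemma shrink_extend_block x B S (b : bool) : set0 \notin S ->
  {in S, forall C : {set T}, x \notin C} -> B \in set0 |: S ->
  shrink_block x (x |: B) (if b then extend_block x B S else S :\ B) = S.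
Proof.
move=> S0 xS BS; have xB : x \notin B.
  by move: BS; rewrite in_setU1 => /orP[/eqP->|/xS //]; rewrite inE.
have XS : x |: B \notin S :\ B.
  by rewrite in_setD negb_and; apply/orP; right; apply/negP => /xS; rewrite setU11.
have -> : shrink_block x (x |: B) (if b then extend_block x B S else S :\ B) =
          (B |: S :\ B) :\ set0.
  rewrite /shrink_block /extend_block setU1K //; case: b; first by rewrite setU1K.
  by congr ((_ |: _) :\ _); apply/setDidPl; rewrite disjoint_sym disjoints1.
apply/setP=> C; rewrite !inE; case: (eqVneq C set0) => [->|C0] /=.
  by rewrite (negbTE S0).
case: (eqVneq C B) => [CB|] //=; move: BS; rewrite in_setU1 -CB (negbTE C0) /=.
by move=> ->.
Qed.

Lemma extend_shrink_block x D P S X : partition P D -> X \in P -> x \in X ->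
  S \subset P ->
  let S' := shrink_block x X S in
  (if X \in S then extend_block x (X :\ x) S' else S' :\ (X :\ x)) = S.
Proof.
move=> PD XP xX SP S'; set B := X :\ x.
have BX : B != X by apply/eqP=> BX; move: xX; rewrite -BX !inE eqxx.
have BP : B != set0 -> B \notin P.
  case/set0Pn=> y yB; apply/negP=> BP; move/eqP: BX; apply.
  by apply: (partition_eq PD BP XP yB); move: yB; rewrite !inE => /andP[].
have S0 : set0 \notin S by apply/negP => /(subsetP SP); rewrite (partition0 PD).
have BS : B \notin S.
  have [->|/BP] := eqVneq B set0 => //.
  by apply: contra; apply: (subsetP SP).
have S'E : S' :\ B = S :\ X.
  apply/setP=> C; rewrite !inE; case: (eqVneq C B) => [->|_] /=.
    by rewrite (negbTE BS) andbF.
  by case: (eqVneq C set0) => [->|_] //=; rewrite (negbTE S0) andbF.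
rewrite /extend_block S'E setD1K //.
case: ifP => [XS|XS]; first by rewrite setD1K.
by apply/setDidPl; rewrite disjoint_sym disjoints1 XS.
Qed.

(* [t.1] is the marked block extended by [x] ([set0] for a new block); [t.2]
   says whether the resulting block is marked. *)
Definition extend_marked x (s : {set {set T}} * {set {set T}}) (t : {set T} * bool) :=
  (extend_block x t.1 s.1, if t.2 then extend_block x t.1 s.2 else s.2 :\ t.1).

Lemma marked_notin D s x B : marked_partition D s -> x \notin D ->
  B \in set0 |: s.2 -> x \notin B.
Proof.
case/andP=> PD /subsetP AP xD; rewrite in_setU1 => /orP[/eqP->|/AP BP].
  by rewrite inE.
exact: partition_notin PD BP xD.
Qed.

Lemma extend_markedP x D s t : marked_partition D s -> x \notin D ->
  t.1 \in set0 |: s.2 -> marked_partition (x |: D) (extend_marked x s t).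
Proof.
case: s t => P A [B b] /= /andP[/= PD AP] xD BA.
rewrite /marked_partition /= extend_block_partition //=; last first.
  by apply: (subsetP (setUS _ AP)).
case: b; first by rewrite setUS // setSD.
by apply: (subset_trans (setSD _ AP)); apply: subsetUr.
Qed.

Variables (R : nmodType) (F : {set {set T}} * {set {set T}} -> R).

(** A marked partition of [x |: D] determines its origin: delete [x] from its block, and let the
    flag record whether that block is marked. The sum is reindexed along this bijection. *)
Lemma sum_marked_partitions x D : x \notin D ->
  \sum_(s | marked_partition (x |: D) s) F s =
  \sum_(s | marked_partition D s)
     \sum_(t : {set T} * bool | t.1 \in set0 |: s.2) F (extend_marked x s t).
Proof.
move=> xD; rewrite pair_big_dep /=.
pose h (j : ({set {set T}} * {set {set T}}) * ({set T} * bool)) :=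
  extend_marked x j.1 j.2.
pose h' (s : {set {set T}} * {set {set T}}) := let X := pblock s.1 x in
  ((shrink_block x X s.1, shrink_block x X s.2), (X :\ x, X \in s.2)).
have hK s t : marked_partition D s -> t.1 \in set0 |: s.2 ->
    h' (h (s, t)) = (s, t).
  case: s t => P A [B b] sD /= BA; case/andP: (sD) => /= PD AP.
  have xB := marked_notin sD xD BA.
  have /andP[/= P'D _] := @extend_markedP x D (P, A) (B, b) sD xD BA.
  have A0 : set0 \notin A by apply/negP => /(subsetP AP); rewrite (partition0 PD).
  have xA : {in A, forall C : {set T}, x \notin C}.
    by move=> C /(subsetP AP) CP; apply: partition_notin PD CP xD.
  rewrite /h /h' /extend_marked /=.
  rewrite (def_pblock (partition_trivIset P'D) (setU11 _ _) (setU11 _ _)).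
  rewrite (@shrink_extend_block _ _ _ true) ?partition0 ?(partition0 PD) //.
  - rewrite shrink_extend_block // setU1K //; congr (_, (_, _)).
    case: b; rewrite ?setU11 // in_setD; apply: contraTF isT.
    by case/andP=> _ /xA; rewrite setU11.
  - by move=> C CP; apply: partition_notin PD CP xD.
  - by apply: (subsetP (setUS _ AP)).
have h'P s : marked_partition (x |: D) s -> [/\ marked_partition D (h' s).1,
     (h' s).2.1 \in set0 |: (h' s).1.2 & h (h' s) = s].
  case: s => P A /andP[/= PD AP]; rewrite /h /h' /extend_marked /=.
  have [XP xX] := partition_pblock PD (setU11 x D).
  set X := pblock P x in XP xX *.
  split.
  - rewrite /marked_partition /= (shrink_block_partition PD) //=.
    by rewrite setSD // setUS // setSD.
  - by rewrite !inE eqxx /= andbT orbN.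
  - rewrite (extend_shrink_block PD XP xX AP).
    by have /= := extend_shrink_block PD XP xX (subxx P); rewrite XP => ->.
rewrite (reindex_onto h h') /=; last by move=> s /h'P[].
apply: eq_bigl => -[s t] /=; apply/andP/andP => [[sD /eqP Es]|[sD tA]].
  by have [] := h'P _ sD; rewrite Es.
by rewrite hK //; split=> //; apply: extend_markedP.
Qed.
End MarkedPartitions.

(** * Weights of the completed blocks and their change at one step *)

Section BlockWeights.
Variable n : nat.
Implicit Types (P A : {set {set 'I_n}}) (B C X : {set 'I_n}) (a i m : 'I_n).

(* When the blocks in [A] are still to receive elements greater than i, the
   element of [Gamma] at i lying in [C] (if any) is at least a. *)
Definition no_earlier A a i C : bool :=
  ((C \in A) || [exists d in C, i <= d]%N) && [exists c in C, c < i]%N ==>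
  [exists c in C, a <= c < i]%N.

(* i is the last element of [B] and gamma at i is 1, a being the element that
   precedes i. *)
Definition first_closed_at P A B i : bool :=
  [exists a in B, [&& (a < i)%N, [forall c in B, (c <= a)%N || (c == i)] &
                     [forall C in P, no_earlier A a i C]]].

Definition first_closed P A B : bool :=
  [exists i in B, first_closed_at P A B i].

Definition last_elt B : nat := \max_(c in B) c.

Definition before m : {set 'I_n} := [set i : 'I_n | (i < m)%N].

Lemma last_elt_ge B c : c \in B -> (c <= last_elt B)%N.
Proof. by move=> cB; rewrite /last_elt (bigD1 c) //= leq_maxl. Qed.

Lemma last_elt_mem B : B != set0 -> exists2 a, a \in B & last_elt B = a.
Proof.
rewrite -card_gt0 => B0.
by have [a aB aE] := eq_bigmax_cond (fun c : 'I_n => c : nat) B0; exists a.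
Qed.

Section Extend.
Variables (m : 'I_n) (P A : {set {set 'I_n}}) (B : {set 'I_n}) (b : bool).
Hypothesis sD : marked_partition (before m) (P, A).
Hypothesis BA : B \in set0 |: A.
Let P' := (extend_marked m (P, A) (B, b)).1.
Let A' := (extend_marked m (P, A) (B, b)).2.

Let mD : m \notin before m. Proof. by rewrite inE ltnn. Qed.
Let PD : partition P (before m). Proof. by case/andP: sD. Qed.
Let AP : A \subset P. Proof. by case/andP: sD. Qed.

Let P_lt C c : C \in P -> c \in C -> (c < m)%N.
Proof. by move=> /(partitionS PD)/subsetP CD /CD; rewrite inE. Qed.

Let B_lt c : c \in B -> (c < m)%N.
Proof.
move: BA; rewrite in_setU1 => /orP[/eqP->|/(subsetP AP)]; first by rewrite inE.
exact: P_lt.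
Qed.

Let XP : m |: B \notin P.
Proof. by apply/negP => /P_lt/(_ (setU11 m B)); rewrite ltnn. Qed.

Let B_mem : B != set0 -> B \in A.
Proof. by move: BA; rewrite in_setU1 => /orP[->|->]. Qed.

(** Only a block left unmarked at [m] is newly complete, so the product of weights gains at most one
    factor. *)
Lemma extend_unmarked :
  P' :\: A' = if b then P :\: A else (m |: B) |: (P :\: A).
Proof.
have BPA : B \notin P :\: A.
  by move: BA; rewrite in_setU1 inE => /orP[/eqP->|->] //; rewrite (partition0 PD) andbF.
have XA : m |: B \notin A by apply: contra XP; apply: (subsetP AP).
apply/setP=> C; rewrite /P' /A' /extend_marked /extend_block.
have [->|CB] := eqVneq C B.
  have BX : (B == m |: B) = false.
    by apply/eqP=> BX; have := setU11 m B; rewrite -BX => /B_lt; rewrite ltnn.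
  by case: b; rewrite !inE BX eqxx /= ?(negbTE BPA) ?andbF //;
     move: BPA; rewrite inE => /negbTE->.
have [->|CX] := eqVneq C (m |: B).
  by case: b; rewrite !inE eqxx /= ?(negbTE XP) ?andbF // (negbTE XA) andbF.
by case: b; rewrite !inE ?(negbTE CX) CB.
Qed.

Lemma no_earlier_extend a i C : C \in P -> C != B ->
  no_earlier A' a i C = no_earlier A a i C.
Proof.
move=> CP CB; rewrite /no_earlier; congr ((_ || _) && _ ==> _).
have CX : C != m |: B by apply: contraNneq XP => <-.
by rewrite /A' /extend_marked /extend_block /=; case: b; rewrite !inE ?(negbTE CX) CB.
Qed.

Lemma no_earlier_extended a i : (i < m)%N ->
  no_earlier A' a i (m |: B) = (B != set0) ==> no_earlier A a i B.
Proof.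
move=> im.
(* A predicate that forces values below [i < m] cannot be witnessed by [m]. *)
have ltX (p : pred nat) : (forall k, p k -> (k < i)%N) ->
    [exists c in m |: B, p c] = [exists c in B, p c].
  move=> pi; apply/exists_inP/exists_inP => -[c cX pc]; exists c => //; last exact: setU1r.
  by case/setU1P: cX => // cm; move: (pi _ pc); rewrite cm ltnNge ltnW.
have [->|B0] /= := eqVneq B set0.
  rewrite /no_earlier setU0; apply/implyP=> /andP[_ /exists_inP[c]].
  by rewrite inE => /eqP->; rewrite ltnNge ltnW.
rewrite /no_earlier B_mem // (ltX (fun k => k < i)%N) // (ltX (fun k => a <= k < i)%N).
  have -> // : [exists d in m |: B, (i <= d)%N].
    by apply/exists_inP; exists m; rewrite ?setU11 // ltnW.
  by rewrite orbT.
by move=> k /andP[].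
Qed.

(** For i < m, the mark on [B] and the element [m] of [m |: B] equally announce an element at least
    i, and a new block [[set m]] has no element below i. So the conditions [no_earlier] are
    unchanged. *)
Lemma first_closed_extend C : C \in P ->
  first_closed P' A' C = first_closed P A C.
Proof.
move=> CP; apply: eq_existsb => i; case iC: (i \in C) => //=.
apply: eq_existsb => a; case aC: (a \in C) => //=; congr [&& _, _ & _].
have im := P_lt CP iC.
apply/forall_inP/forall_inP => H D DP.
  have [DB|DB] := eqVneq D B.
    have B0 : B != set0 by rewrite -DB (partition_neq0 PD DP).
    by have := H _ (setU11 _ _); rewrite no_earlier_extended // B0 DB.
  by rewrite -no_earlier_extend // H // !inE DB DP orbT.
case/setU1P: DP => [->|].
  rewrite no_earlier_extended //; apply/implyP=> /B_mem/(subsetP AP).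
  exact: H.
by rewrite 2!inE => /andP[DB DP]; rewrite no_earlier_extend // H.
Qed.

(** The marked blocks are those that receive an element at least [m], and each is represented in
    [Gamma] at [m] by its last element so far. The representative of [B] is the one preceding
    [m]. *)
Lemma first_closed_extended : B != set0 -> ~~ b ->
  first_closed P' A' (m |: B) = [forall C in A, last_elt B <= last_elt C]%N.
Proof.
move=> B0 /negbTE bF; have [z zB zE] := last_elt_mem B0.
have A'E : A' = A :\ B by rewrite /A' /extend_marked bF.
have neP C c : C \in P -> c \in C -> [exists c in C, (c < m)%N].
  by move=> CP cC; apply/exists_inP; exists c => //; apply: P_lt CP cC.
apply/exists_inP/forall_inP => [[i iX /exists_inP[a aX]]|H].
  case/and3P=> ai /forall_inP ca /forall_inP H C CA.
  (* If i were in [B], then [ca] at [m] would give m <= a < i < m, unless m = i. *)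
  have im : i = m.
    case/setU1P: iX => // iB; have := ca m (setU11 _ _); move: (B_lt iB).
    move=> im /orP[ma|/eqP->] //; have := leq_trans (leq_trans ai (ltnW im)) ma.
    by rewrite ltnn.
  rewrite {i iX}im in ai ca H.
  have aB : a \in B by case/setU1P: aX => // am; move: ai; rewrite am ltnn.
  have za : (z <= a)%N.
    case/orP: (ca z (setU1r _ zB)) => // /eqP zm.
    by have := B_lt zB; rewrite zm ltnn.
  have CP := subsetP AP _ CA.
  have [->//|CB] := eqVneq C B.
  have : no_earlier A' a m C by apply: H; rewrite /extend_block !inE CB CP orbT.
  have [c cC] := set0Pn _ (partition_neq0 PD CP).
  rewrite /no_earlier A'E in_setD1 CB CA (neP C c) //= => /exists_inP[e eC /andP[ae _]].
  by rewrite zE; apply: leq_trans za (leq_trans ae (last_elt_ge eC)).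
exists m; first exact: setU11.
apply/exists_inP; exists z; first exact: setU1r.
rewrite B_lt //=; apply/andP; split; apply/forall_inP.
  by move=> c /setU1P[->|cB]; rewrite ?eqxx ?orbT // -zE last_elt_ge.
move=> C /setU1P[->|].
  apply/implyP=> _; apply/exists_inP; exists z; first exact: setU1r.
  by rewrite leqnn B_lt.
rewrite inE => /andP[CB CP].
apply/implyP=> /andP[/orP[CA'|/exists_inP[d dC md]] _]; last first.
  by have := P_lt CP dC; rewrite ltnNge md.
have CA : C \in A by move: CA'; rewrite A'E in_setD1 => /andP[].
have [c cC cE] := last_elt_mem (partition_neq0 PD CP).
apply/exists_inP; exists c => //.
by rewrite (P_lt CP cC) -zE -cE H.
Qed.

End Extend.

Variables (R : comNzRingType) (rho sigma : R).

(** A non-singleton block gets its [rho] here once complete. While it is open, its [rho], already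
    paid by an up step, sits in the separate factor [rho ^+ #|A|]. *)
Definition block_weight P A B : R :=
  if #|B| == 1%N then rho + sigma - 1
  else rho * (if first_closed P A B then sigma else 1).

Definition unmarked_weight (s : {set {set 'I_n}} * {set {set 'I_n}}) : R :=
  \prod_(B in s.1 :\: s.2) block_weight s.1 s.2 B.

(** Blocks are disjoint, so their last elements differ and exactly one marked block attains the
    minimum; every other one contributes 1. *)
Lemma sum_first m P A : partition P (before m) -> A \subset P ->
  \sum_(B in A) (if [forall C in A, last_elt B <= last_elt C]%N then sigma else 1) =
  if #|A| is k.+1 then sigma + k%:R else 0.
Proof.
move=> PD AP; have [->|/set0Pn[B1 B1A]] := eqVneq A set0.
  by rewrite big_set0 cards0.
have [B0 B0A minB0] := arg_minnP last_elt B1A.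
have {}B0A : B0 \in A by [].
rewrite (bigD1 B0) //= (cardsD1 B0) B0A add1n.
have -> : [forall C in A, last_elt B0 <= last_elt C]%N by apply/forall_inP.
congr (_ + _); rewrite -sumr_const.
apply: eq_big => [B|B /andP[BA BB0]]; first by rewrite !inE andbC.
case: ifP => // /forall_inP /(_ _ B0A) le0.
have [c cB cE] := last_elt_mem (partition_neq0 PD (subsetP AP _ BA)).
have [c0 cB0 c0E] := last_elt_mem (partition_neq0 PD (subsetP AP _ B0A)).
have := minB0 _ BA; rewrite cE c0E => le1; case/eqP: BB0.
have cc0 : c = c0 by apply/val_inj/eqP; rewrite /= eqn_leq le1 andbT -cE -c0E.
by apply: (partition_eq PD (subsetP AP _ BA) (subsetP AP _ B0A) cB); rewrite cc0.
Qed.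

(** The Charlier parameters spread over the steps: [level h] is x_(h+1), and y_h is the up weight
    [rho] times [down h]. *)
Definition level (h : nat) : R := rho + sigma - 1 + h%:R.
Definition down (h : nat) : R := sigma + h%:R - 1.

Lemma unmarked_weight_extend m P A B b :
  marked_partition (before m) (P, A) -> B \in set0 |: A ->
  unmarked_weight (extend_marked m (P, A) (B, b)) = unmarked_weight (P, A) *
  (if b then 1 else if B == set0 then rho + sigma - 1 else
     rho * (if [forall C in A, last_elt B <= last_elt C]%N then sigma else 1)).
Proof.
have mD : m \notin before m by rewrite inE ltnn.
move=> sD BA; have mB := marked_notin sD mD BA; case/andP: (sD) => /= PD AP.
have prodE : \prod_(C in P :\: A) block_weight (extend_marked m (P, A) (B, b)).1
               (extend_marked m (P, A) (B, b)).2 C = unmarked_weight (P, A).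
  apply: eq_bigr => C /setDP[CP _].
  by rewrite /block_weight first_closed_extend.
rewrite {1}/unmarked_weight extend_unmarked //.
case: b prodE => prodE; first by rewrite prodE mulr1.
rewrite big_setU1; last first.
  apply/negP => /setDP[/(partitionS PD)/subsetP/(_ m)].
  by rewrite setU11 inE ltnn => /(_ isT).
rewrite prodE mulrC {1}/block_weight cardsU1 mB.
rewrite add1n eqSS cards_eq0; have [_|B0] := eqVneq B set0; first by [].
by rewrite first_closed_extended.
Qed.

(** A nonempty [B] uses up one open block and the flag creates one. The balance is written
    additively to avoid truncated subtraction. *)
Lemma card_extend_marked m P A B b :
  marked_partition (before m) (P, A) -> B \in set0 |: A ->
  (#|(extend_marked m (P, A) (B, b)).2| + (B != set0) = #|A| + b)%N.
Proof.
move=> sD BA; case/andP: (sD) => /= PD AP.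
have E : (#|A :\ B| + (B != set0) = #|A|)%N.
  rewrite (cardsD1 B A) addnC; congr (_ + _)%N.
  move: BA; rewrite in_setU1; have [->|] := eqVneq B set0; last by move=> _ /= ->.
  by case A0: (set0 \in A) => //; have := subsetP AP _ A0; rewrite (partition0 PD).
case: b; rewrite /= /extend_block ?addn0 //.
rewrite cardsU1 -addnA E addnC; suff -> : m |: B \notin A :\ B by [].
rewrite in_setD negb_and; apply/orP; right; apply/negP=> /(subsetP AP).
by move=> /(partitionS PD)/subsetP/(_ _ (setU11 m B)); rewrite inE ltnn.
Qed.

(* A new element at height [#|A|] is a singleton or an opener ([B = set0]), or
   it extends one of the [#|A|] open blocks, as a closer or as a transient. *)
Lemma sum_extend_marked m s (N : nat -> R) : marked_partition (before m) s ->
  \sum_(t : {set 'I_n} * bool | t.1 \in set0 |: s.2)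
     unmarked_weight (extend_marked m s t) *
     (rho ^+ #|(extend_marked m s t).2| * N #|(extend_marked m s t).2|) =
  unmarked_weight s * (rho ^+ #|s.2| *
    (level #|s.2| * N #|s.2| + rho * N #|s.2|.+1 +
     if #|s.2| is h.+1 then down #|s.2| * N h else 0)).
Proof.
case: s => P A sD; case/andP: (sD) => /= PD AP.
pose G B b := unmarked_weight (extend_marked m (P, A) (B, b)) *
     (rho ^+ #|(extend_marked m (P, A) (B, b)).2| *
      N #|(extend_marked m (P, A) (B, b)).2|).
transitivity (\sum_(B in set0 |: A) \sum_b G B b).
  rewrite pair_big_dep; apply: eq_big => [[B b]|[B b] _] //=.
  by rewrite andbT.
have A0 : set0 \notin A by apply/negP => /(subsetP AP); rewrite (partition0 PD).
rewrite big_setU1 //= big_bool /=.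
set W := unmarked_weight (P, A); set h := #|A|.
have GE B b : B \in set0 |: A -> G B b =
     W * (if b then 1 else if B == set0 then rho + sigma - 1 else
     rho * (if [forall C in A, last_elt B <= last_elt C]%N then sigma else 1)) *
     (rho ^+ (h + b - (B != set0)) * N (h + b - (B != set0))%N).
  move=> BA; rewrite /G unmarked_weight_extend //.
  by rewrite -(card_extend_marked b sD BA) addnK.
clearbody W.
have G0 b : G set0 b = W * (if b then 1 else rho + sigma - 1) *
                       (rho ^+ (h + b) * N (h + b)%N).
  by rewrite GE ?setU11 // eqxx subn0.
(* For empty [A] both sums are empty, so the value of [h.-1] at 0 does no harm. *)
have GA : \sum_(B in A) \sum_b G B b =
   \sum_(B in A) (W * (rho ^+ h * N h) +
     W * rho ^+ h *
     (if [forall C in A, last_elt B <= last_elt C]%N then sigma else 1) * N h.-1).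
  apply: eq_bigr => B BA; have B0 : B != set0 by apply: contraNneq A0 => <-.
  rewrite big_bool /= !GE ?inE ?BA ?orbT // B0 addn1 addn0 !subn1 /= mulr1; congr (_ + _).
  have : (0 < h)%N by rewrite /h (cardsD1 B) BA.
  rewrite (negbTE B0); case: (h) => // k _; rewrite exprS /=.
  set v := (if _ then _ else _); set w := N k; set r := rho ^+ k.
  by clearbody v w r; clear; ring.
rewrite GA big_split /= sumr_const -[X in _ + (X + _)]mulr_natr -/h !G0.
rewrite -big_distrl -big_distrr /= (sum_first PD AP) -/h.
rewrite addn0 addn1 exprS /level /down.
clear GE G0 GA G; clearbody h.
move: (N h) (N h.+1) (rho ^+ h) => N0 N1 r.
case: h => [|h]; first by rewrite mulr0; ring.
move: (N h) => N2; rewrite -addn1 natrD /=. ring.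
Qed.

End BlockWeights.

(** * The statistic [g1bar] read off the blocks of a full partition *)

Section Gamma1.
Variable n : nat.
Implicit Types (P A : {set {set 'I_n}}) (B C X S : {set 'I_n}) (a i : 'I_n).

Lemma index_enum_eq0 S a : a \in S ->
  (index a (enum S) == 0%N) = [forall c in S, a <= c]%N.
Proof.
move=> aS; have aE : a \in enum S by rewrite mem_enum.
have cE c : (c \in S) = (c \in enum S) by rewrite mem_enum.
have sE : sorted (fun x y : 'I_n => x <= y)%N (enum S).
  rewrite /enum_mem -enumT.
  apply: sorted_filter => [x y z|]; first exact: leq_trans.
  by have := iota_sorted 0 n; rewrite -val_enum_ord sorted_map.
case: (enum S) aE cE sE => [|x s] // aE cE /=
  /(order_path_min (fun _ _ _ => @leq_trans _ _ _)).
move=> /allP xs; apply/idP/forall_inP => [|H].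
  case: (eqVneq x a) => // <- _ c; rewrite cE inE => /orP[/eqP->//|/xs//].
have := H x; rewrite cE mem_head => /(_ isT) ax.
case: (eqVneq x a) => // xa; move: aE; rewrite inE eq_sym (negbTE xa) /= => /xs xla.
by case/eqP: xa; apply/val_inj/eqP; rewrite /= eqn_leq xla.
Qed.

Variable P : {set {set 'I_n}}.
Hypothesis PT : partition P [set: 'I_n].

Lemma precedesE B a i : B \in P -> i \in B ->
  precedes P a i = [&& a \in B, (a < i)%N & [forall c in B, ~~ (a < c < i)%N]].
Proof.
move=> BP iB; apply/exists_inP/and3P => [[C CP /and4P[aC iC ai H]]|[aB ai H]].
  by rewrite (partition_eq PT BP CP iB iC).
by exists B => //; apply/and4P.
Qed.

Lemma precedes_inj a a' i : precedes P a i -> precedes P a' i -> a = a'.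
Proof.
case/exists_inP=> B BP /and4P[aB iB ai /forall_inP H].
rewrite (precedesE a' BP iB) => /and3P[a'B a'i /forall_inP H'].
apply/val_inj/eqP; rewrite /= eqn_leq.
by have := H _ a'B; have := H' _ aB; rewrite ai a'i !andbT -!leqNgt => -> ->.
Qed.

Lemma closerE B i : B \in P -> i \in B ->
  is_closer P i = (1 < #|B|)%N && [forall c in B, c <= i]%N.
Proof.
move=> BP iB; apply/exists_inP/andP => [[C CP /and3P[C1 iC H]]|[B1 H]].
  by rewrite (partition_eq PT BP CP iB iC).
by exists B => //; apply/and3P.
Qed.

(** An element with a successor shares its block with a larger element, so it is neither a singleton
    nor a closer, hence an opener or a transient. *)
Lemma mem_Gamma i a : (a \in Gamma P i) =
  (a < i)%N && [exists b, precedes P a b && (i <= b)%N].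
Proof.
rewrite inE; apply: andb_idl => /andP[_ /existsP[b /andP[/exists_inP[B BP]]]].
case/and4P=> aB bB ab _ _; rewrite /is_transient; case: is_opener => //=.
apply/andP; split.
  apply/negP=> aP; have BE := partition_eq PT BP aP aB (set11 a).
  by move: bB; rewrite BE inE => /eqP ba; rewrite ba ltnn in ab.
rewrite (closerE BP aB) negb_and; apply/orP; right; apply/forall_inPn.
by exists b; rewrite // -ltnNge.
Qed.

(** Each block with elements both below i and at least i has exactly one element in [Gamma], its
    largest one below i; that one is at least a when the block meets [a, i). *)
Lemma Gamma_le i a : (a < i)%N ->
  [forall c in Gamma P i, a <= c]%N = [forall C in P, no_earlier set0 a i C].
Proof.
move=> ai; apply/forall_inP/forall_inP => H.
  move=> C CP; apply/implyP=> /andP[]; rewrite inE /=.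
  move=> /exists_inP[d dC id_] /exists_inP[c cC ci].
  (* The largest element of [C] below [i] and the smallest one at least [i] are consecutive in
     [C]. *)
  have [a' /andP[a'C a'i] maxa'] :=
    @arg_maxnP _ c [pred c in C | c < i]%N (fun c : 'I_n => c : nat)
      (introT andP (conj cC ci)).
  have [b /andP[bC ib] minb] :=
    @arg_minnP _ d [pred c in C | i <= c]%N (fun c : 'I_n => c : nat)
      (introT andP (conj dC id_)).
  apply/exists_inP; exists a' => //; rewrite a'i andbT; apply: H.
  rewrite mem_Gamma a'i; apply/existsP; exists b; rewrite ib andbT.
  rewrite (precedesE _ CP bC) a'C (leq_trans a'i ib) /=.
  apply/forall_inP=> e eC; apply/negP=> /andP[a'e eb].
  have [ei|ie] := ltnP e i.
    by have := maxa' e; rewrite /= eC ei => /(_ isT); rewrite leqNgt a'e.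
  by have := minb e; rewrite /= eC ie => /(_ isT); rewrite leqNgt eb.
move=> c; rewrite mem_Gamma => /andP[ci /existsP[b /andP[/exists_inP[C CP]]]].
case/and4P=> cC bC cb /forall_inP gap ib.
have Cprec : ((C \in set0) || [exists d in C, i <= d]%N) && [exists e in C, e < i]%N.
  by apply/andP; split; [apply/orP; right|]; apply/exists_inP; [exists b|exists c].
have /implyP/(_ Cprec)/exists_inP[e eC /andP[ae ei]] := H C CP.
(* If [e] exceeded [c], it would lie strictly between [c] and its successor [b]. *)
apply: leq_trans ae _; rewrite leqNgt; apply: contra (gap _ eC) => ->.
exact: leq_trans ei ib.
Qed.

(** [gamma] is 1 when the predecessor has index 0 in the increasing list, that is, when it is the
    minimum of [Gamma]; [Gamma_le] does the rest. The dummy value 0 is never 1. *)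
Lemma closer_gamma1E i : is_closer P i && (gamma P i == 1%N) =
  first_closed_at P set0 (pblock P i) i.
Proof.
have [BP iB] := partition_pblock PT (in_setT i).
set B := pblock P i in BP iB *.
rewrite (closerE BP iB) /gamma.
apply/andP/exists_inP => [[/andP[_ /forall_inP maxi]]|[a aB /and3P[ai /forall_inP H G]]].
  case: pickP => // a ai; rewrite eqSS.
  move: (ai); rewrite (precedesE _ BP iB) => /and3P[aB lai /forall_inP gap].
  have aG : a \in Gamma P i.
    by rewrite mem_Gamma lai; apply/existsP; exists i; rewrite ai leqnn.
  rewrite index_enum_eq0 // Gamma_le // => G; exists a => //.
  rewrite lai G andbT /=; apply/forall_inP=> c cB.
  have := gap _ cB; rewrite negb_and -!leqNgt => /orP[->//|ic].
  by rewrite -val_eqE /= eqn_leq ic maxi ?orbT.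
have maxi c : c \in B -> (c <= i)%N.
  by move=> /H/orP[ca|/eqP->//]; apply: leq_trans ca (ltnW ai).
have pai : precedes P a i.
  rewrite (precedesE _ BP iB) aB ai; apply/forall_inP=> c /H/orP[ca|/eqP->].
    by rewrite ltnNge ca.
  by rewrite ltnn andbF.
split.
  apply/andP; split; last by apply/forall_inP.
  apply/card_gt1P; exists a, i; split=> //.
  by apply: contraTneq ai => ->; rewrite ltnn.
case: pickP => [a'|/(_ a)]; last by rewrite pai.
move/(precedes_inj pai) => <-; rewrite eqSS index_enum_eq0 ?Gamma_le //.
by rewrite mem_Gamma ai; apply/existsP; exists i; rewrite pai leqnn.
Qed.

(** A block has a single maximum, so [pblock] is injective on the counted closers. *)
Lemma g1bar_first_closed : g1bar P = #|[set B in P | first_closed P set0 B]|.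
Proof.
rewrite /g1bar; set S := [set i | _].
have SE i : (i \in S) = first_closed_at P set0 (pblock P i) i.
  by rewrite inE closer_gamma1E.
have -> : [set B in P | first_closed P set0 B] = pblock P @: S.
  apply/setP=> B; rewrite inE; apply/andP/imsetP => [[BP]|[i iS ->]].
    case/exists_inP=> i iB iH; have BE := def_pblock (partition_trivIset PT) BP iB.
    by exists i; rewrite // SE BE.
  have [BP iB] := partition_pblock PT (in_setT i).
  by split=> //; apply/exists_inP; exists i; rewrite // -SE.
rewrite card_in_imset // => i j; rewrite !inE => /andP[ci _] /andP[cj _] Eij.
have [BP iB] := partition_pblock PT (in_setT i).
have [_ jB] := partition_pblock PT (in_setT j); rewrite -Eij in jB.
move: ci cj; rewrite (closerE BP iB) (closerE BP jB).
move=> /andP[_ /forall_inP maxi] /andP[_ /forall_inP maxj].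
by apply/val_inj/eqP; rewrite /= eqn_leq maxi // maxj.
Qed.

Lemma prodr_exp_bool (R : comNzRingType) (I : finType) (S : {set I})
    (p : pred I) (x : R) :
  \prod_(k in S) x ^+ p k = x ^+ #|[set k in S | p k]|.
Proof.
rewrite -prodr_const (bigID p) /= [X in _ * X]big1 ?mulr1.
  apply: eq_big => [k|k /andP[_ ->]] //; by rewrite inE.
by move=> k /andP[_ /negbTE->].
Qed.

Lemma unmarked_weightE (R : comNzRingType) (rho sigma : R) :
  unmarked_weight rho sigma (P, set0) =
  rho ^+ nonsingleton_blocks P * sigma ^+ g1bar P *
    (rho + sigma - 1) ^+ singleton_blocks P.
Proof.
rewrite /unmarked_weight setD0 g1bar_first_closed /nonsingleton_blocks /singleton_blocks.
rewrite -!prodr_exp_bool -!big_split; apply: eq_bigr => B BP; rewrite /block_weight /=.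
have B0 : (0 < #|B|)%N by rewrite card_gt0 (partition_neq0 PT BP).
case: (eqVneq #|B| 1%N) => [B1|B1].
  (* A singleton has no element before its last one. *)
  have -> : first_closed P set0 B = false.
    apply/exists_inP => -[i iB /exists_inP[a aB /andP[ai _]]].
    by case/eqP/cards1P: B1 iB aB ai => j ->; rewrite !inE => /eqP-> /eqP->;
      rewrite ltnn.
  by rewrite B1 ltnn !mul1r.
have -> : (1 < #|B|)%N by rewrite ltn_neqAle eq_sym B1.
by rewrite expr1 expr0 mulr1; case: first_closed.
Qed.

End Gamma1.

(** * The invariant sum and its two extreme values *)

Section Moments.
Variables (R : comNzRingType) (rho sigma : R) (n : nat).

(** In the induction, [sum_marked_partitions] lists the ways to insert the next element, and
    [sum_extend_marked] gathers them into the first step of the remaining path. *)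
Lemma motzkin_marked_sum k : (k <= n)%N ->
  \sum_(s | marked_partition [set i : 'I_n | (i < k)%N] s)
     unmarked_weight rho sigma s * (rho ^+ #|s.2| *
       motzkin (fun=> rho) (level rho sigma) (down sigma) (n - k) #|s.2|) =
  motzkin (fun=> rho) (level rho sigma) (down sigma) n 0.
Proof.
elim: k => [|k IHk] lekn.
  (* For k = 0 the only marked partition is the empty one, of weight 1. *)
  rewrite (big_pred1 (set0, set0)) => [|[P A]] /=.
    by rewrite /unmarked_weight setD0 big_set0 cards0 expr0 !mul1r subn0.
  rewrite /marked_partition /=; have -> : [set i : 'I_n | (i < 0)%N] = set0.
    by apply/setP=> i; rewrite !inE.
  rewrite partition_set0; apply/andP/eqP => [[/eqP-> /=]|[-> ->]]; last by rewrite eqxx subxx.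
  by rewrite subset0 => /eqP->.
rewrite -IHk; last exact: ltnW.
pose m := Ordinal lekn.
have -> : [set i : 'I_n | (i < k.+1)%N] = m |: before m.
  by apply/setP=> i; rewrite !inE ltnS leq_eqVlt -val_eqE.
rewrite sum_marked_partitions ?inE ?ltnn //; apply: eq_bigr => s sD.
rewrite sum_extend_marked //; congr (_ * (_ * _)).
by rewrite -(subnSK lekn).
Qed.

Lemma motzkin_partition_sum :
  motzkin (fun=> rho) (level rho sigma) (down sigma) n 0 =
  \sum_(P : {set {set 'I_n}} | partition P [set: 'I_n])
     rho ^+ nonsingleton_blocks P * sigma ^+ g1bar P *
     (rho + sigma - 1) ^+ singleton_blocks P.
Proof.
rewrite -(motzkin_marked_sum (leqnn n)) subnn.
have -> : [set i : 'I_n | (i < n)%N] = setT by apply/setP=> i; rewrite !inE ltn_ord.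
(* A path of length 0 has weight 0 unless it starts at height 0, so terms with a marked block
   vanish. *)
rewrite (bigID (fun s => s.2 == set0)) /= [X in _ + X]big1 ?addr0; last first.
  by move=> s /andP[_]; rewrite -cards_eq0 => /negbTE->; rewrite !mulr0.
rewrite (reindex_onto (fun P => (P, set0)) (fun s => s.1)) /=.
  apply: eq_big => [P|P]; first by rewrite /marked_partition /= sub0set !eqxx !andbT.
  by rewrite /marked_partition /= => /andP[/andP[/andP[PT _] _] _];
     rewrite cards0 eqxx expr0 !mulr1 unmarked_weightE.
by move=> [P A] /andP[_ /= /eqP->].
Qed.

End Moments.

Theorem proposition11p7 (R : realType) (rho sigma : R) (n : nat)
    (hrho : 0 < rho <= 1) (hsigma : 1 <= sigma) :
  jfrac_moment (charlier_x rho sigma) (charlier_y rho sigma) n =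
  \sum_(P : {set {set 'I_n}} | partition P [set: 'I_n])
     rho ^+ nonsingleton_blocks P * sigma ^+ g1bar P *
     (rho + sigma - 1) ^+ singleton_blocks P.
Proof.
rewrite -motzkin_partition_sum; symmetry; apply: motzkin_jfrac_moment => k.
  by rewrite /charlier_x /level -addn1 natrD; ring.
by rewrite /charlier_y /down.
Qed.
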